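(* Let $A$ be an $n\times n$ Hermitian matrix with characteristic polynomial $$f_A(\lambda)=(\lambda-\lambda_1(A))^{\mu_1}(\lambda-\lambda_2(A))^{\mu_2}\cdots(\lambda-\lambda_d(A))^{\mu_d},$$ where $\lambda_1(A),\dots,\lambda_d(A)$ are the distinct eigenvalues of $A$ and $\mu_j$ is the algebraic multiplicity of $\lambda_j(A)$. Let $i\in\{1,\dots,d\}$, let $v_{i1},v_{i2},\dots,v_{i\mu_i}$ be orthonormal eigenvectors of $A$ corresponding to $\lambda_i(A)$, and let $S\subset[n]$ with $|S|=\mu_i$. Then $$\left|\det\left([v_{i1},\dots,v_{i\mu_i}]_{S}\right)\right|^2=\frac{\prod_{j=1}^{n-\mu_i}\left(\lambda_i(A)-\lambda_j(M_S)\right)}{\prod_{j=1;\,j\neq i}^{d}\left(\lambda_i(A)-\lambda_j(A)\right)^{\mu_j}}.$$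
   Context: Here $[n]=\{1,2,\dots,n\}$. For $S\subset[n]$, $M_S$ denotes the submatrix obtained from $A$ by deleting the rows and columns with indices belonging to $S$. When $|S|=\mu_i$, $M_S$ has order $n-\mu_i$, and $\lambda_1(M_S),\dots,\lambda_{n-\mu_i}(M_S)$ denote its eigenvalues, listed with multiplicity. $[v_{i1},\dots,v_{i\mu_i}]$ is the $n\times\mu_i$ matrix whose columns are the vectors $v_{i1},\dots,v_{i\mu_i}$, and $[v_{i1},\dots,v_{i\mu_i}]_S$ is its $\mu_i\times\mu_i$ submatrix consisting of the rows with indices in $S$. Empty products are equal to $1$. *)

(* Defs.v *)
From HB Require Import structures.
From mathcomp Require Import all_boot all_order all_algebra.

Set Implicit Arguments.
Unset Strict Implicit.
Unset Printing Implicit Defensive.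

Import Order.TTheory GRing.Theory Num.Theory.
Local Open Scope ring_scope.

(* [enum_val] lists the elements of a set of ordinals in increasing order, so
   both definitions keep the original order of rows and columns. *)
Definition delete_mx (C : Type) (n : nat) (A : 'M[C]_n) (S : {set 'I_n}) :
    'M[C]_#|~: S| :=
  mxsub (@enum_val _ (mem (~: S))) (@enum_val _ (mem (~: S))) A.

Definition rows_mx (C : Type) (n m : nat) (V : 'M[C]_(n, m)) (S : {set 'I_n}) :
    'M[C]_(#|S|, m) :=
  rowsub (@enum_val _ (mem S)) V.

Definition cols_mx (C : Type) (n m : nat) (v : 'I_m -> 'cV[C]_n) :
    'M[C]_(n, m) :=
  \matrix_(a < n, k < m) v k a 0.

Definition orthonormal_family (C : numClosedFieldType) (n m : nat)
    (v : 'I_m -> 'cV[C]_n) : Prop :=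
  forall k l : 'I_m, \sum_(a < n) v k a 0 * (v l a 0)^* = (k == l)%:R.

(* Main.v *)
(** Let V be the matrix of the given eigenvectors, a the eigenvalue, and
    B = a - A, so that B V = 0, V^H B = 0 and V^H V = 1.  Bordering the
    identity columns outside S with V gives a matrix Q with |det Q| = |det V_S|,
    and Q^H (B + V V^H) Q has the same determinant as the principal submatrix of
    B outside S.  On the other hand A - V V^H has the spectrum of A with the
    eigenvalue a shifted to a - 1, so det (B + V V^H) is the product of the
    (a - lambda_j)^mu_j over the other eigenvalues. *)
Require Import Defs.
From HB Require Import structures.
From mathcomp Require Import all_boot all_order all_fingroup all_algebra.

Set Implicit Arguments.
Unset Strict Implicit.
Unset Printing Implicit Defensive.

Import Order.TTheory GRing.Theory Num.Theory.
Local Open Scope ring_scope.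
Local Open Scope sesquilinear_scope.

Lemma horner_char_poly (R : comNzRingType) n (A : 'M[R]_n) (x : R) :
  (char_poly A).[x] = \det (x%:M - A).
Proof.
rewrite -[LHS]/(horner_eval x _) -det_map_mx; congr (\det _).
by apply/matrixP=> a b; rewrite !mxE /= /horner_eval !hornerE hornerMn hornerX.
Qed.

(** An injection between index sets of equal size is a permutation; it acts on rows and columns
    alike, so its sign occurs twice and cancels. *)
Lemma det_mxsub_inj (R : comNzRingType) m n (f : 'I_m -> 'I_n) (A : 'M[R]_n) :
  m = n -> injective f -> \det (mxsub f f A) = \det A.
Proof.
move=> emn; case: _ / emn in f A * => injf.
have -> : mxsub f f A = row_perm (perm injf) (col_perm (perm injf) A).
  by apply/matrixP=> a b; rewrite !mxE !permE.
rewrite row_permE col_permE !det_mulmx !det_perm odd_permV mulrCA.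
by rewrite -expr2 sqrr_sign mulr1.
Qed.

(* Both sides are computed from the determinant of [block_mx c%:M V (- W) 1%:M]. *)
Lemma det_scalar_add_mul (R : comNzRingType) n m (c : R)
    (V : 'M[R]_(n, m)) (W : 'M[R]_(m, n)) :
  c ^+ m * \det (c%:M + V *m W) = c ^+ n * \det (c%:M + W *m V).
Proof.
pose M := block_mx c%:M V (- W) 1%:M.
have /(congr1 determinant) : M *m block_mx 1%:M 0 W 1%:M =
    block_mx (c%:M + V *m W) V 0 1%:M.
  by rewrite mulmx_block !mulmx1 !mul1mx !mulmx0 !add0r addNr.
rewrite det_mulmx det_lblock det_ublock !det1 !mulr1 => detM.
have /(congr1 determinant) : block_mx 1%:M 0 W c%:M *m M =
    block_mx c%:M V 0 (c%:M + W *m V).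
  rewrite mulmx_block !mul1mx !mul0mx !addr0 mulmx1 addrC [_ + W *m V]addrC.
  by rewrite mulmxN mul_scalar_mx mul_mx_scalar addNr.
by rewrite det_mulmx det_lblock det_ublock !det_scalar expr1n mul1r detM.
Qed.

(* In [{poly R}], [('X - A) (('X - a) + V W) = ('X - a) ('X - (A - V W))]. *)
Lemma char_poly_deflation (R : idomainType) n m (A : 'M[R]_n) (a : R)
    (V : 'M[R]_(n, m)) (W : 'M[R]_(m, n)) :
  A *m V = a *: V -> W *m V = 1%:M ->
  ('X - a%:P) ^+ m * char_poly (A - V *m W) =
  ('X - a%:P + 1) ^+ m * char_poly A.
Proof.
move=> AV WV; set c := 'X - a%:P.
have c_neq0 : c ^+ n != 0 by rewrite expf_neq0 // polyXsubC_eq0.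
pose V' := map_mx polyC V; pose W' := map_mx polyC W.
have WV' : W' *m V' = 1%:M by rewrite -map_mxM WV map_mx1.
have /(congr1 determinant) :
    char_poly_mx A *m (c%:M + V' *m W') = c *: char_poly_mx (A - V *m W).
  rewrite mulmxDr mul_mx_scalar mulmxA mulmxBl mul_scalar_mx.
  rewrite -[map_mx polyC A *m _]map_mxM AV map_mxZ /= -/V' -scalerBl -/c.
  rewrite -scalemxAl -scalerDr /char_poly_mx map_mxB map_mxM /= opprB.
  by rewrite addrCA addrC.
rewrite det_mulmx detZ => eq1.
(* As [W' V' = 1], the right-hand determinant is that of the scalar matrix [c + 1] of size [m]; the
   common factor [c ^+ n] can then be cancelled. *)
have := det_scalar_add_mul c V' W'; rewrite WV' => eq2.
apply: (mulfI c_neq0); rewrite mulrCA /char_poly -eq1 mulrCA eq2.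
by rewrite -raddfD det_scalar mulrCA [X in _ * X]mulrC.
Qed.

(* With [Q = (1 Vu; 0 Vd)] and [Q' = (1 0; Wl Wr)], the hypotheses give
   [Q' (B + V W) Q = (1 Vu; 0 1) (Bul 0; 0 1) (1 0; Wl 1)]. *)
Lemma det_ulsubmx_corank (R : comNzRingType) p m (B : 'M[R]_(p + m))
    (V : 'M[R]_(p + m, m)) (W : 'M[R]_(m, p + m)) :
  B *m V = 0 -> W *m B = 0 -> W *m V = 1%:M ->
  \det (ulsubmx B) = \det (dsubmx V) * \det (rsubmx W) * \det (B + V *m W).
Proof.
move=> BV WB WV; pose E : 'M[R]_(p + m, p) := col_mx 1%:M 0.
pose Q := row_mx E V; pose Q' := col_mx E^T W.
have eQ : Q = block_mx 1%:M (usubmx V) 0 (dsubmx V).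
  by rewrite block_mxEh vsubmxK.
have eQ' : Q' = block_mx 1%:M 0 (lsubmx W) (rsubmx W).
  by rewrite block_mxEv hsubmxK -[X in row_mx X _]trmx1 -trmx0 -tr_col_mx.
have EBE : E^T *m B *m E = ulsubmx B.
  rewrite -{1}(submxK B) /E tr_col_mx trmx1 trmx0 mul_row_block !mul1mx.
  by rewrite !mul0mx !addr0 mul_row_col mulmx1 mulmx0 addr0.
have EV : E^T *m V = usubmx V.
  rewrite -{1}(vsubmxK V) /E tr_col_mx trmx1 trmx0 mul_row_col.
  by rewrite mul1mx mul0mx addr0.
have WE : W *m E = lsubmx W.
  by rewrite -{1}(hsubmxK W) /E mul_row_col mulmx1 mulmx0 addr0.
have /(congr1 determinant) : Q' *m (B + V *m W) *m Q =
    block_mx 1%:M (usubmx V) 0 1%:M *m block_mx (ulsubmx B) 0 0 1%:M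
    *m block_mx 1%:M 0 (lsubmx W) 1%:M.
  rewrite /Q' /Q mul_col_mx mul_col_row !mulmxDr !mulmxA WB WV EV mul1mx add0r.
  rewrite !mulmxDl -!mulmxA BV WV WE !mulmx1 mulmx0 add0r mulmxA EBE.
  by rewrite !mulmx_block !(mulmx1, mul1mx, mulmx0, mul0mx, addr0, add0r).
rewrite !det_mulmx !det_lblock !det_ublock eQ eQ' det_lblock det_ublock !det1.
by rewrite !(mul1r, mulr1) => <-; rewrite mulrC mulrA.
Qed.

(** Renumbering the indices with the complement of [S] first turns the principal submatrix into an
    upper left block, which reduces the claim to [det_ulsubmx_corank]. *)
Lemma det_delete_corank (R : comNzRingType) n m (B : 'M[R]_n)
    (V : 'M[R]_(n, m)) (W : 'M[R]_(m, n)) (S : {set 'I_n}) (cardS : #|S| = m) :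
  B *m V = 0 -> W *m B = 0 -> W *m V = 1%:M ->
  \det (delete_mx B S) =
    \det (castmx (cardS, erefl m) (rows_mx V S)) *
    \det (castmx (cardS, erefl m) (rows_mx W^T S)) * \det (B + V *m W).
Proof.
case: _ / cardS in V W * => BV WB WV; rewrite !castmx_id.
pose f (x : 'I_(#|~: S| + #|S|)) : 'I_n :=
  match split x with inl a => enum_val a | inr b => enum_val b end.
have fl a : f (lshift _ a) = enum_val a by rewrite /f (unsplitK (inl a)).
have fr a : f (rshift _ a) = enum_val a by rewrite /f (unsplitK (inr a)).
have f_inj : injective f.
  move=> x y; rewrite -(splitK x) -(splitK y).
  case: (split x) (split y) => [a|a] [b|b] /=; rewrite ?fl ?fr.
  - by move/enum_val_inj->.
  - by move=> eab; have := enum_valP a; rewrite eab inE enum_valP.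
  - by move=> eab; have := enum_valP b; rewrite -eab inE enum_valP.
  - by move/enum_val_inj->.
have cardf : (#|~: S| + #|S|)%N = n by rewrite addnC cardsC card_ord.
have f_onto : bijective f.
  by apply: inj_card_bij => //; rewrite !card_ord cardf.
(* The bijection [f] merely permutes the terms of the inner sum, so the three relations between [B],
   [V] and [W] survive the renumbering. *)
have fmul p q (X : 'M[R]_(p, n)) (Y : 'M[R]_(n, q)) :
    colsub f X *m rowsub f Y = X *m Y.
  apply/matrixP=> a b; rewrite !mxE (reindex f) /=; last exact: onW_bij.
  by apply: eq_bigr => c _; rewrite !mxE.
have fBV : mxsub f f B *m rowsub f V = 0.
  by rewrite mxsubrc mul_rowsub_mx fmul BV; apply/matrixP=> a b; rewrite !mxE.
have fWB : colsub f W *m mxsub f f B = 0.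
  by rewrite (mxsubcr f f B) mulmx_colsub fmul WB; apply/matrixP=> a b; rewrite !mxE.
have := det_ulsubmx_corank fBV fWB (etrans (fmul _ _ _ _) WV).
rewrite -mxsub_mul -raddfD /= (det_mxsub_inj _ cardf f_inj).
have -> : ulsubmx (mxsub f f B) = delete_mx B S.
  by apply/matrixP=> a b; rewrite !mxE !fl.
have -> : dsubmx (rowsub f V) = rows_mx V S.
  by apply/matrixP=> a b; rewrite !mxE !fr.
have -> // : rsubmx (colsub f W) = (rows_mx W^T S)^T.
  by apply/matrixP=> a b; rewrite !mxE !fr.
by rewrite det_tr.
Qed.

Lemma orthonormal_cols (C : numClosedFieldType) n m (v : 'I_m -> 'cV[C]_n) :
  orthonormal_family v -> (cols_mx v) ^t* *m cols_mx v = 1%:M.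
Proof.
move=> ov; apply/matrixP=> k l; rewrite !mxE.
(* The conjugate falls on the vector of index [k] here, but on the second vector in
   [orthonormal_family]; hence the relation is used for [l] and [k]. *)
under eq_bigr do rewrite !mxE mulrC.
by rewrite ov eq_sym.
Qed.

Lemma delete_scalar_sub (R : pzRingType) n (a : R) (A : 'M[R]_n)
    (S : {set 'I_n}) : delete_mx (a%:M - A) S = a%:M - delete_mx A S.
Proof. by apply/matrixP=> x y; rewrite !mxE (inj_eq enum_val_inj). Qed.

Theorem theorem2 (C : numClosedFieldType) (n : nat) (A : 'M[C]_n)
    (A_herm : A \is hermsymmx)
    (d : nat) (lambda : 'I_d -> C) (mu : 'I_d -> nat)
    (lambda_inj : injective lambda)
    (mu_gt0 : forall j : 'I_d, (0 < mu j)%N)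
    (char_A : char_poly A = \prod_(j < d) ('X - (lambda j)%:P) ^+ mu j)
    (i : 'I_d) (v : 'I_(mu i) -> 'cV[C]_n)
    (v_eigen : forall k : 'I_(mu i), A *m v k = lambda i *: v k)
    (v_orthonormal : orthonormal_family v)
    (S : {set 'I_n}) (card_S : #|S| = mu i)
    (nu : 'I_(n - mu i) -> C)
    (char_MS : char_poly (delete_mx A S) =
       \prod_(j < n - mu i) ('X - (nu j)%:P)) :
  `|\det (castmx (card_S, erefl (mu i)) (rows_mx (cols_mx v) S))| ^+ 2 =
  (\prod_(j < n - mu i) (lambda i - nu j)) /
  (\prod_(j < d | j != i) (lambda i - lambda j) ^+ mu j).
Proof.
set a := lambda i; set V := cols_mx v; pose W := V ^t*.
have WV : W *m V = 1%:M by exact: orthonormal_cols.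
have AV : A *m V = a *: V.
  apply/matrixP=> x k; have /matrixP/(_ x 0) := v_eigen k.
  by rewrite !mxE => <-; apply: eq_bigr => y _; rewrite !mxE.
(* This is the conjugate transpose of [A V = a V], with [A] Hermitian. *)
have WA : W *m A = a^* *: W.
  have := congr1 (fun X => X ^t*) AV.
  rewrite /= trmx_mul map_mxM linearZ /= map_mxZ -/W => <-; congr (_ *m _).
  by move/is_hermitianmxP: A_herm; rewrite expr0 scale1r.
(* Computing [W A V] in two ways gives [a^*] and [a] times the identity; a diagonal entry exists
   because [mu i] is positive. *)
have a_real : a^* = a.
  have : W *m A *m V = W *m (A *m V) by rewrite mulmxA.
  rewrite WA AV -scalemxAl -scalemxAr WV.
  move/matrixP/(_ (Ordinal (mu_gt0 i)) (Ordinal (mu_gt0 i))).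
  by rewrite !mxE eqxx !mulr1.
pose g := \prod_(j < d | j != i) ('X - (lambda j)%:P) ^+ mu j.
have g_a : g.[a] = \prod_(j < d | j != i) (a - lambda j) ^+ mu j.
  by rewrite horner_prod; apply: eq_bigr => j _; rewrite horner_exp hornerXsubC.
have g_a_neq0 : g.[a] != 0.
  rewrite g_a; apply/prodf_neq0 => j ji; rewrite expf_neq0 // subr_eq0.
  by apply: contraNneq ji => /lambda_inj->.
have detBVW : \det (a%:M - A + V *m W) = g.[a].
  (* The factor [('X - a) ^+ mu i] vanishes at [a], so it is cancelled between polynomials before
     evaluation; the remaining [('X - a + 1) ^+ mu i] takes the value 1 there. *)
  have := char_poly_deflation AV WV.
  have Xa_neq0 : ('X - a%:P) ^+ mu i != 0 by rewrite expf_neq0 ?polyXsubC_eq0.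
  rewrite char_A (bigD1 i) //= -/g -/a mulrCA => /(mulfI Xa_neq0) eq_defl.
  rewrite -addrA -[V *m W]opprK -opprD -horner_char_poly.
  by rewrite eq_defl hornerM horner_exp !hornerE subrr add0r expr1n mul1r.
have BV : (a%:M - A) *m V = 0 by rewrite mulmxBl mul_scalar_mx AV subrr.
have WB : W *m (a%:M - A) = 0 by rewrite mulmxBr mul_mx_scalar WA a_real subrr.
have := det_delete_corank card_S BV WB WV.
(* The two minors are therefore conjugate, and their product is the squared modulus. *)
have -> : rows_mx W^T S = (rows_mx V S) ^ Num.conj.
  by apply/matrixP=> x y; rewrite !mxE.
rewrite -map_castmx det_map_mx -normCK detBVW -g_a delete_scalar_sub.
rewrite -horner_char_poly char_MS horner_prod => detE.
apply: (canRL (mulfK g_a_neq0)); rewrite -detE.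
by apply: eq_bigr => j _; rewrite hornerXsubC.
Qed.
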